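(* Let $\mathcal U=\{\xi\in\mathfrak g^*:\xi_{\alpha_i}=\langle\xi,e_{-\alpha_i}\rangle\ne0,\ i=1,\dots,N\}$. The formula $$g(\xi)=\exp\Big(\sum_{i=1}^N\sum_{j=1}^N(C_{ji}\log\xi_{\alpha_j})\,h_{\alpha_i}\Big)$$ defines an $H$-equivariant map $g:\mathcal U\to H$, i.e. $g(Ad^*_{h^{-1}}\xi)=h\cdot g(\xi)$ for all $h\in H$, $\xi\in\mathcal U$.
   Context: $\mathfrak g$ is a simple Lie algebra over $\mathbb C$ with Killing form $(\cdot,\cdot)$ and a fixed Cartan subalgebra $\mathfrak h$ of dimension $N$; $\Delta$ is the root system and $\Pi=\{\alpha_1,\dots,\alpha_N\}\subset\Delta$ a fixed simple system. For each positive root $\alpha$, $e_\alpha\in\mathfrak g_\alpha$ and $e_{-\alpha}\in\mathfrak g_{-\alpha}$ are root vectors dual with respect to $(\cdot,\cdot)$. For $\alpha\in\Delta$, $h_\alpha\in\mathfrak h$ is the coroot: $\beta(h_\alpha)=2\frac{(\beta,\alpha)}{(\alpha,\alpha)}$ for $\beta\in\mathfrak h^*$. $A=(A_{ij})$, $A_{ij}=\alpha_j(h_{\alpha_i})$, is the Cartan matrix and $C=(C_{ij})$ is its inverse. $G$ is a simple Lie group with Lie algebra $\mathfrak g$, and $H\subset G$ is the Lie subgroup (Cartan subgroup) corresponding to $\mathfrak h$; it is generated by any small neighborhood of $1$. $Ad^*$ is defined by $\langle Ad_x^*\xi,Y\rangle=\langle\xi,Ad_xY\rangle$; $H$ acts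 on $\mathfrak g^*$ by the coadjoint action $\xi\mapsto Ad^*_{h^{-1}}\xi$ (which preserves $\mathcal U$) and on itself by left translation. A branch of the logarithmic function is fixed.
   Formalization: ''Simple Lie group'' is taken to mean simple as an abstract group (so connected with trivial centre): for G = SL_2(C) the claim fails, since -1 in H acts trivially on the dual of the Lie algebra but not on H by translation. *)

(* Defs.v *)
From HB Require Import structures.
From mathcomp Require Import all_boot all_order all_algebra.
From mathcomp Require Import all_classical all_reals all_analysis.
From mathcomp Require Import complex.

Set Implicit Arguments.
Unset Strict Implicit.
Unset Printing Implicit Defensive.

Import Order.TTheory GRing.Theory Num.Theory.
Import numFieldNormedType.Exports.

Local Open Scope classical_set_scope.
Local Open Scope ring_scope.
Local Open Scope complex_scope.

Definition expC (R : realType) (z : R[i]) : R[i] :=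
  let: a +i* b := z in (expR a * cos b) +i* (expR a * sin b).

(* The branch [log] is total on the punctured plane and continuous on a dense
   domain; on the cut it may take any admissible value.  [R[i]] only carries
   its topology under the alias [R[i]^o]. *)
Definition log_branch (R : realType) (log : R[i]^o -> R[i]^o) : Prop :=
  (forall z, z != 0 -> expC (log z) = z) /\
  exists D : set R[i]^o,
    [/\ open D, connected D, dense D, ~ D 0 & forall z, D z -> {for z, continuous log}].

Record lieBracket (K : fieldType) (L : vectType K) := LieBracket {
  lie_fun :> L -> L -> L;
  lie_linl : forall a x y z, lie_fun (a *: x + y) z = a *: lie_fun x z + lie_fun y z;
  lie_linr : forall a x y z, lie_fun z (a *: x + y) = a *: lie_fun z x + lie_fun z y;
  lie_alt : forall x, lie_fun x x = 0;
  lie_jacobi : forall x y z,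
    lie_fun x (lie_fun y z) + lie_fun y (lie_fun z x) + lie_fun z (lie_fun x y) = 0
}.

Section LieAlgebra.
Variables (K : fieldType) (L : vectType K) (br : lieBracket L).

Definition lie_abelian (a : {vspace L}) : Prop :=
  {in a &, forall x y, br x y = 0}.

Definition lie_ideal (I : {vspace L}) : Prop :=
  forall x y, y \in I -> br x y \in I.

Definition lie_simple : Prop :=
  ~ lie_abelian fullv /\
  forall I : {vspace L}, lie_ideal I -> I = 0%VS \/ I = fullv.

Definition vtrace (f : L -> L) : K :=
  \sum_(i < \dim {:L}) coord (vbasis {:L}) i (f (vbasis {:L})`_i).

Definition killing (x y : L) : K := vtrace (br x \o br y).

Definition ad_semisimple (x : L) : Prop :=
  exists2 b : seq L, basis_of fullv b &
    forall v, v \in b -> exists l, br x v = l *: v.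

(* [K] is meant to be algebraically closed here: semisimple = diagonalizable. *)
Definition cartan_subalgebra (h : {vspace L}) : Prop :=
  [/\ lie_abelian h,
      forall a : {vspace L}, lie_abelian a -> (h <= a)%VS -> a = h
    & forall x, x \in h -> ad_semisimple x].

Section Roots.
Variable h : {vspace L}.

Definition hdual := 'Hom(subvs_of h, K^o).

Definition root_space (a : hdual) (x : L) : Prop :=
  forall H : subvs_of h, br (vsval H) x = a H *: x.

Definition is_root (a : hdual) : Prop :=
  a != 0 /\ exists2 x, x != 0 & root_space a x.

(* The isomorphism [h -> h^*] given by the restriction of the Killing form. *)
Definition killing_flat : 'Hom(subvs_of h, hdual) :=
  linfun (fun H : subvs_of h =>
    linfun (fun H' : subvs_of h => killing (vsval H) (vsval H') : K^o)).

Definition dual_form (a b : hdual) : K :=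
  killing (vsval ((killing_flat^-1)%VF a)) (vsval ((killing_flat^-1)%VF b)).

Definition is_coroot (a : hdual) (ha : subvs_of h) : Prop :=
  forall b : hdual, b ha = 2 * dual_form b a / dual_form a a.

Section SimpleSystem.
Variables (N : nat) (alpha : 'I_N -> hdual).

Definition nat_comb (b : hdual) : Prop :=
  exists c : 'I_N -> nat, b = \sum_(i < N) alpha i *+ c i.

Definition simple_system : Prop :=
  [/\ forall i, is_root (alpha i),
      basis_of fullv (codom alpha)
    & forall b, is_root b -> nat_comb b \/ nat_comb (- b)].

Definition positive_root (b : hdual) : Prop := is_root b /\ nat_comb b.

Definition dual_root_vectors (e : hdual -> L) : Prop :=
  forall b, positive_root b ->
    [/\ root_space b (e b), root_space (- b) (e (- b))
      & killing (e b) (e (- b)) = 1].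

Definition cartan_matrix (hh : hdual -> subvs_of h) : 'M[K]_N :=
  \matrix_(i, j) alpha j (hh (alpha i)).

End SimpleSystem.
End Roots.
End LieAlgebra.

(* [chart_map] and [chart_inv] are only meaningful on [chart_dom] and on its
   image. *)
Record chart (M E : Type) := Chart {
  chart_dom : set M;
  chart_map : M -> E;
  chart_inv : E -> M
}.

Section Manifold.
Variable K : numFieldType.

Definition chart_axiom (M : topologicalType) (E : normedModType K)
    (c : chart M E) : Prop :=
  let V := chart_map c @` chart_dom c in
  [/\ open (chart_dom c), open V,
      forall x, chart_dom c x -> chart_inv c (chart_map c x) = x,
      forall x, chart_dom c x -> {for x, continuous (chart_map c)}
    & forall v, V v -> {for v, continuous (chart_inv c)}].

(* A map is holomorphic if it is continuous and complex differentiable in all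
   charts. *)
Definition holomorphic (M N : topologicalType) (E F : normedModType K)
    (A : set (chart M E)) (B : set (chart N F)) (f : M -> N) : Prop :=
  continuous f /\
  forall c d x, A c -> B d -> chart_dom c x -> chart_dom d (f x) ->
    differentiable (chart_map d \o f \o chart_inv c) (chart_map c x).

Definition manifold_atlas (M : topologicalType) (E : normedModType K)
    (A : set (chart M E)) : Prop :=
  [/\ hausdorff_space M, @second_countable M,
      forall c, A c -> chart_axiom c,
      forall x, exists2 c, A c & chart_dom c x
    & forall c d x, A c -> A d -> chart_dom c x -> chart_dom d x ->
        differentiable (chart_map d \o chart_inv c) (chart_map c x)].

Definition prod_chart (M N E F : Type) (c : chart M E) (d : chart N F) :
    chart (M * N) (E * F) :=
  Chart (chart_dom c `*` chart_dom d)
    (fun p => (chart_map c p.1, chart_map d p.2))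
    (fun p => (chart_inv c p.1, chart_inv d p.2)).

Definition prod_atlas (M N E F : Type)
    (A : set (chart M E)) (B : set (chart N F)) :
    set (chart (M * N) (E * F)) :=
  [set prod_chart c d | c in A & d in B].

Definition model_atlas (E : Type) : set (chart E E) := [set Chart setT id id].

End Manifold.

(* No compatibility between the two structures is assumed at this point. *)
#[short(type="groupTopologicalType")]
HB.structure Definition GroupTopological := {G of Group G & Topological G}.

Section Groups.
Variable G : groupType.
Implicit Types K S : set G.

Definition subgroup_set K : Prop :=
  [/\ K 1%g, forall x y, K x -> K y -> K (x * y)%g & forall x, K x -> K (x^-1)%g].

Definition normal_set K : Prop :=
  subgroup_set K /\ forall x y, K y -> K (x * y * x^-1)%g.

(* Simple as an abstract group, which is stronger for a Lie group than having a
   simple Lie algebra: it forces connectedness and a trivial centre.  For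
   [SL_2(C)] no equivariant map [U -> H] exists, since [-1] acts trivially on
   [U] but not on [H]. *)
Definition simple_group : Prop :=
  (exists x : G, x <> 1%g) /\
  forall K, normal_set K -> K = [set 1%g] \/ K = [set: G].

Definition generated_subgroup S : set G :=
  [set x | forall K, subgroup_set K -> S `<=` K -> K x].

End Groups.

Definition lie_group_atlas (K : numFieldType) (E : normedModType K)
    (G : groupTopologicalType) (A : set (chart G E)) : Prop :=
  [/\ manifold_atlas A,
      holomorphic (prod_atlas A A) A (fun p : G * G => (p.1 * p.2)%g)
    & holomorphic A A (fun x : G => (x^-1)%g)].

(* The adjoint action, read in [L] through an identification [theta] of [L]
   with the tangent space at the identity in the chart [c]. *)
Definition adjoint (K : numFieldType) (n : nat) (L : vectType K) (G : groupTopologicalType)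
    (c : chart G 'rV[K]_n) (theta : 'Hom(L, 'rV[K]_n)) (x : G) : 'End(L) :=
  (theta^-1
   \o linfun ('d (chart_map c \o (fun y : G => (x * y * x^-1)%g) \o chart_inv c)
                (chart_map c 1%g) : 'rV[K]_n -> 'rV[K]_n)
   \o theta)%VF.

(* A Lie group whose Lie algebra, i.e. the tangent space at [1] with the
   bracket for which [ad] is the differential of [Ad] at [1], is identified
   with [(L, br)]. *)
Record lieGroup (K : numFieldType) (L : vectType K) (br : lieBracket L) := LieGroup {
  lg_sort :> groupTopologicalType;
  lg_dim : nat;
  lg_atlas : set (chart lg_sort 'rV[K]_lg_dim);
  lg_chart1 : chart lg_sort 'rV[K]_lg_dim;
  lg_tangent : 'Hom(L, 'rV[K]_lg_dim);
  lg_atlasP : lie_group_atlas lg_atlas;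
  lg_chart1P : lg_atlas lg_chart1;
  lg_chart1_1 : chart_dom lg_chart1 1%g;
  lg_tangent_bij : bijective lg_tangent;
  lg_bracketP : forall Y : L,
    is_diff (chart_map lg_chart1 1%g)
      (fun u => lg_tangent (adjoint lg_chart1 lg_tangent (chart_inv lg_chart1 u) Y))
      (fun v => lg_tangent (br ((lg_tangent^-1)%VF v) Y))
}.

Arguments lg_dim {K L br} l.
Arguments lg_atlas {K L br} l.
Arguments lg_chart1 {K L br} l.
Arguments lg_tangent {K L br} l.

Section LieGroup.
Variables (K : numFieldType) (L : vectType K) (br : lieBracket L) (G : lieGroup br).

Definition Ad (x : G) : 'End(L) := adjoint (lg_chart1 G) (lg_tangent G) x.

Definition Ad_star (x : G) (xi : 'Hom(L, K^o)) : 'Hom(L, K^o) := (xi \o Ad x)%VF.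

(* For each [X], [t |-> exp (t X)] is the one-parameter subgroup with initial
   velocity [X]. *)
Definition is_exponential (Exp : L -> G) : Prop :=
  forall X : L,
    [/\ holomorphic (@model_atlas K^o) (lg_atlas G) (fun t : K^o => Exp (t *: X)),
        forall s t : K, Exp ((s + t) *: X) = (Exp (s *: X) * Exp (t *: X))%g
      & is_derive (0 : K^o) (1 : K^o)
          (fun t : K^o => chart_map (lg_chart1 G) (Exp (t *: X))) (lg_tangent G X)].

(* The connected Lie subgroup with Lie algebra [h] is the subgroup generated by
   the exponentials of elements of [h]. *)
Definition integral_subgroup (Exp : L -> G) (h : {vspace L}) : set G :=
  generated_subgroup [set Exp X | X in [set X | X \in h]].

End LieGroup.

Section Map.
Variables (R : realType) (L : vectType R[i]) (br : lieBracket L) (G : lieGroup br).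
Variables (Exp : L -> G) (h : {vspace L}) (N : nat) (alpha : 'I_N -> hdual h).
Variables (e : hdual h -> L) (hh : hdual h -> subvs_of h) (C : 'M[R[i]]_N).
Variable log : R[i]^o -> R[i]^o.

(* The coordinate [xi_a] of [xi] is the pairing of [xi] with [e_(-a)]. *)
Definition root_coord (xi : 'Hom(L, R[i]^o)) (a : hdual h) : R[i]^o := xi (e (- a)).

Definition Uset : set 'Hom(L, R[i]^o) :=
  [set xi | forall i, root_coord xi (alpha i) != 0].

Definition gmap (xi : 'Hom(L, R[i]^o)) : G :=
  Exp (\sum_(i < N) \sum_(j < N)
         (C j i * log (root_coord xi (alpha j))) *: vsval (hh (alpha i))).

End Map.

(* Main.v *)
Require Import Defs.
From HB Require Import structures.
From mathcomp Require Import all_boot all_order all_algebra.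
From mathcomp Require Import all_classical all_reals all_analysis.
From mathcomp Require Import complex.
From mathcomp Require Import ring.
From mathcomp Require spectral.
Import Order.TTheory GRing.Theory Num.Theory.
Import numFieldNormedType.Exports.
Local Open Scope classical_set_scope.
Local Open Scope ring_scope.

(** Why the map is equivariant.  Let X be in the Cartan subalgebra and x = Exp X.
Since Ad (Exp (- X)) multiplies e_(-alpha_i) by expC (alpha_i X), the coadjoint
action of x^-1 multiplies the coordinate xi_(alpha_i) by expC (alpha_i X).  For
numbers c_1, ..., c_N put P(c) = sum_i sum_j (C_ji c_j) h_(alpha_i); because C
inverts the Cartan matrix, alpha_k (P(c)) = c_k.  Hence the two elements of the
Cartan subalgebra whose exponentials are g (Ad^*_(x^-1) xi) and x * g xi differ
by an element Z such that expC (alpha_k Z) = 1 for all k: a logarithm of a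
product is the sum of the logarithms up to a period of expC.  Exponentials of
commuting elements multiply, so all that remains is Exp Z = 1.

Every eigenvalue of ad Z is the value at Z of a weight, which is zero or an
integer combination of simple roots, so expC sends it to 1.  As Z is
ad-semisimple, Ad (Exp Z) is the identity [Ad_Exp_id].  Then Exp Z centralizes
the image of Exp.  The centralizer of that image is a normal subgroup of G, and
it is not G because the Lie algebra is not abelian; simplicity of G makes it
trivial, so Exp Z = 1 [eq1_of_Ad_id].

The Lie theory this uses is developed from the definition of a Lie group by
charts, and rests on two facts.  First, a one-parameter subgroup is determined
by its velocity at 0 [one_param_unique]: if g1 and g2 have the same velocity,
g1(t) g2(-t) has zero velocity at t = 0, hence, being translated by fixed
elements of G, at every t near 0, so it is constant.  This gives
x Exp(Y) x^-1 = Exp (Ad x Y) [Exp_Ad] and, for commuting X and Y,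
Exp (X + Y) = Exp X Exp Y [ExpD].  Second, s |-> Ad (Exp (s X)) Y has derivative
Ad (Exp (s X)) [X, Y] [is_derive_Ad_Exp]; if [X, Y] = l Y this is a linear
differential equation whose only solution is expC (l s) Y [Ad_Exp_eigen].  Both
facts reduce to the mean value theorem for real functions by restricting
holomorphic curves to real segments and taking real and imaginary parts. *)

Set Implicit Arguments.
Unset Strict Implicit.
Unset Printing Implicit Defensive.


(** * Derivatives of curves in a normed space *)

Section Curves.
Variable K : numFieldType.

Lemma is_derive_comp_diff (V W : normedModType K) (g : K^o -> V) (f : V -> W) t v :
  is_derive (t : K^o) (1 : K^o) g v -> differentiable f (g t) ->
  is_derive (t : K^o) (1 : K^o) (f \o g) ('d f (g t) v).
Proof.
case=> /derivable1_diffP dg <- df.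
have dfg : differentiable (f \o g) t by apply: differentiable_comp.
split; first exact/derivable1_diffP.
by rewrite deriveE // diff_comp //= deriveE.
Qed.

Lemma is_derive_rescale (V : normedModType K) (f : K^o -> V) (a t : K) v :
  is_derive (a * t : K^o) (1 : K^o) f v ->
  is_derive (t : K^o) (1 : K^o) (fun s => f (a * s)) (a *: v).
Proof.
case=> /derivable1_diffP df <-.
have dm : is_diff (t : K^o) (fun s : K^o => a * s : K^o) (fun s => a * s).
  exact: (@is_diff_scaler _ K^o).
have dfm : is_diff (t : K^o) (f \o (fun s : K^o => a * s : K^o))
    ('d f (a * t : K^o) \o (fun s : K^o => a * s : K^o)).
  by apply: is_diff_comp; exact: differentiableP.
split; first by apply/derivable1_diffP.
rewrite deriveE //= diff_val /= deriveE //.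
by rewrite -linearZ.
Qed.

Lemma is_derive_translate (V : normedModType K) (f : K^o -> V) (t : K) v :
  is_derive (0 : K^o) (1 : K^o) (fun s => f (t + s)) v ->
  is_derive (t : K^o) (1 : K^o) f v.
Proof.
move=> [d1 d2]; rewrite /derivable /derive in d1 d2.
have E : (fun h : K =>
      h^-1 *: (((fun s => f (t + s)) \o shift 0) (h *: (1:K^o)) - f (t + 0))) =
  (fun h : K => h^-1 *: ((f \o shift t) (h *: (1:K^o)) - f t)).
  by apply/funext => h /=; rewrite !addr0 [t + _]addrC.
by split; rewrite /derivable /derive -E.
Qed.

Lemma is_derive_linear (V W : normedModType K) (f : {linear V -> W})
    (g : K^o -> V) (t : K) v :
  continuous f -> is_derive (t : K^o) (1 : K^o) g v ->
  is_derive (t : K^o) (1 : K^o) (f \o g) (f v).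
Proof.
move=> fc dg.
rewrite -[f v]/((f : V -> W) v) -[in X in is_derive _ _ _ X](diff_lin (g t) fc).
exact: is_derive_comp_diff dg (@linear_differentiable _ _ _ f _ fc).
Qed.

Lemma is_derive_coord n (g : K^o -> 'rV[K]_n) (t : K) v j :
  is_derive (t : K^o) (1 : K^o) g v ->
  is_derive (t : K^o) (1 : K^o) (fun s => g s ord0 j : K^o) (v ord0 j).
Proof.
move=> dg.
have @f : {linear 'rV[K]_n -> K^o}.
  by exists (fun N : 'rV[K]_n => N ord0 j); do 2![eexists]; do ?[constructor];
     rewrite ?mxE// => ? *; rewrite ?mxE//; move=> ?; rewrite !mxE.
have fc : continuous f by exact: coord_continuous.
exact: (is_derive_linear fc dg).
Qed.

End Curves.

(** * Holomorphic curves along real segments and the complex exponential *)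

Section RealParts.
Variable R : realType.
Local Notation C := R[i].
Local Open Scope complex_scope.

(** The map p stands for the real or the imaginary part: it is real linear and
1-Lipschitz, so the real difference quotient is p of the complex one taken along
the increment h * w. *)
Lemma is_derive_real_part (p : C -> R) (F : C^o -> C^o) (w : C) (s : R) (d : C) :
    {morph p : x y / x - y} -> (forall r z, p (r%:C * z) = r * p z) ->
    (forall z, `|p z|%:C <= `|z|) ->
  is_derive (s%:C * w : C^o) (1 : C^o) F d ->
  is_derive s (1 : R) (fun r => p (F (r%:C * w))) (p (d * w)).
Proof.
move=> pB pZ ple [/derivable1_diffP dF dFE].
have Dw : 'D_(w : C^o) F (s%:C * w) = d * w.
  rewrite deriveE // -[w in 'd _ _ w]mulr1 [LHS]linearZ /= -deriveE // dFE.
  by rewrite mulrC.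
have Hl : derivable F (s%:C * w : C^o) (w : C^o) by exact: diff_derivable.
rewrite /derivable -/(derive F (s%:C * w) w) Dw in Hl.
suff H : (fun h : R => h^-1 *: (((fun r => p (F (r%:C * w))) \o shift s) (h *: (1:R))
    - p (F (s%:C * w)))) @ 0^' --> p (d * w).
  split; first by apply/cvg_ex; eexists; exact: H.
  exact/cvg_lim.
apply/cvgrPdist_lt => e e0.
have eC : (0 : C) < e%:C by rewrite ltcR.
move/cvgrPdist_lt : Hl => /(_ _ eC).
rewrite !near_withinE => /nbhs_ballP[r /= r0 Hr].
have rE : r = (complex.Re r)%:C by rewrite RRe_real// gtr0_real.
apply/nbhs_ballP; exists (complex.Re r) => /=; first by rewrite -ltcR -rE.
move=> h /= hr h0.
have := Hr h%:C; rewrite /ball /= !sub0r !normrN in hr *.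
have nh : `|h%:C| = `|h|%:C by rewrite normc_def /= expr0n /= addr0 sqrtr_sqr.
rewrite nh rE ltcR => /(_ hr).
have hc0 : h%:C != 0 by apply: contra_neq h0 => -[].
move=> /(_ hc0) H.
rewrite -ltcR; apply: le_lt_trans H.
apply: le_trans (ple _).
rewrite pB.
have E (z : C^o) : h%:C^-1 *: z = h^-1%:C * z by rewrite fmorphV.
rewrite E pZ pB lecR le_eqVlt; apply/orP; left; apply/eqP.
congr `| _ - _ * (p (F _) - _)|.
by rewrite /= -[_ *: 1]/(h * 1) mulr1 rmorphD mulrDl -[_ *: w]/(_ * w).
Qed.

Lemma is_derive_Re (F : C^o -> C^o) (w : C) (s : R) (d : C) :
  is_derive (s%:C * w : C^o) (1 : C^o) F d ->
  is_derive s (1 : R) (fun r => complex.Re (F (r%:C * w))) (complex.Re (d * w)).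
Proof.
apply: is_derive_real_part; first by case=> a b [c e].
  by move=> r [a b] /=; rewrite mul0r subr0.
exact: normc_ge_Re.
Qed.

Lemma is_derive_Im (F : C^o -> C^o) (w : C) (s : R) (d : C) :
  is_derive (s%:C * w : C^o) (1 : C^o) F d ->
  is_derive s (1 : R) (fun r => complex.Im (F (r%:C * w))) (complex.Im (d * w)).
Proof.
apply: is_derive_real_part; first by case=> a b [c e].
  by move=> r [a b] /=; rewrite mul0r addr0.
(* The imaginary part of z is minus the real part of z * 'i. *)
move=> z; have := normc_ge_Re (z * 'i); rewrite ReiNIm normrN normrM.
by rewrite [`|'i|]normc_def /= expr0n expr1n add0r sqrtr1 mulr1.
Qed.

Lemma is_derive01_0_eq (f : R -> R) :
  (forall s : R, 0 <= s <= 1 -> is_derive s (1 : R) f 0) -> f 1 = f 0.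
Proof.
move=> Hd; apply/eqP; rewrite -subr_eq0.
have [||c _ ->] := @MVT_segment R f (fun=> 0) 0 1 ler01; last by rewrite mul0r.
  by move=> x; rewrite in_itv /= => /andP[? ?]; apply: Hd; rewrite !ltW.
apply: derivable_within_continuous => x; rewrite in_itv /= => xi.
by have [] := Hd x xi.
Qed.

(** The hypothesis is local, on the segment from 0 to w, because F will be a curve
read in a chart. *)
Lemma eq_of_derive0 (F : C^o -> C^o) (w : C) :
  (forall s : R, 0 <= s <= 1 -> is_derive (s%:C * w : C^o) (1 : C^o) F 0) ->
  F w = F 0.
Proof.
move=> Hd.
have HR := @is_derive01_0_eq (fun r => complex.Re (F (r%:C * w))).
have HI := @is_derive01_0_eq (fun r => complex.Im (F (r%:C * w))).
have E0 : (0 : R)%:C * w = 0 by rewrite mul0r.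
have E1 : (1 : R)%:C * w = w by rewrite mul1r.
rewrite E0 E1 in HR HI.
apply/eqP; rewrite eq_complex; apply/andP; split; apply/eqP.
  by apply: HR => s /Hd/is_derive_Re; rewrite mul0r.
by apply: HI => s /Hd/is_derive_Im; rewrite mul0r.
Qed.

Lemma eq_of_derive0_rV n (F : C^o -> 'rV[C]_n) (w : C) :
  (forall s : R, 0 <= s <= 1 -> is_derive (s%:C * w : C^o) (1 : C^o) F 0) ->
  F w = F 0.
Proof.
move=> Hd; apply/rowP => j.
apply: (eq_of_derive0 (F := fun t => F t ord0 j)) => s si.
by have := is_derive_coord j (Hd s si); rewrite mxE.
Qed.

Lemma expCD (z w : C) : expC (z + w) = expC z * expC w.
Proof.
case: z w => [a b] [c d] /=; rewrite expRD cosD sinD /expC.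
by apply/eqP; rewrite eq_complex /=; apply/andP; split; apply/eqP; ring.
Qed.

Lemma expC0 : expC (0 : C) = 1.
Proof. by rewrite /expC /= expR0 cos0 sin0 mulr1 mulr0. Qed.

Lemma expCN (z : C) : expC z * expC (- z) = 1.
Proof. by rewrite -expCD subrr expC0. Qed.

Lemma expC_neq0 (z : C) : expC z != 0.
Proof.
by apply: contra_eq_neq (expCN z) => ->; rewrite mul0r eq_sym oner_eq0.
Qed.

(** The function t |-> expC (- l * t) * F t is constant.  Writing F = u + i v on
the real segment from 0 to 1 turns this into the vanishing of two real
derivatives, so that expC never has to be differentiated as a complex function. *)
Lemma expC_ode (F : C^o -> C^o) (l : C) :
  (forall t, is_derive (t : C^o) (1 : C^o) F (l * F t)) ->
  F 1 = expC l * F 0.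
Proof.
move=> Hd.
suff H : expC (- l) * F 1 = F 0 by rewrite -H mulrA expCN mul1r.
have DR s := is_derive_Re (Hd (s%:C * 1)).
have DI s := is_derive_Im (Hd (s%:C * 1)).
pose u r := complex.Re (F (r%:C * 1)); pose v r := complex.Im (F (r%:C * 1)).
rewrite -/u -/v in DR DI.
case: l Hd DR DI => [a b] Hd DR DI.
have {}DR s : is_derive s (1 : R) u (a * u s - b * v s).
  have := DR s; rewrite /u /v; case: (F (s%:C * 1)) => x y /=.
  by rewrite /= !mulr1 mulr0 subr0.
have {}DI s : is_derive s (1 : R) v (a * v s + b * u s).
  have := DI s; rewrite /u /v; case: (F (s%:C * 1)) => x y /=.
  by rewrite /= !mulr1 mulr0 add0r.
have Dm c s : is_derive s (1 : R) (fun s => c * s) c.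
  have := @is_deriveZ R R^o R^o id c s 1 1 (is_derive_id _ _).
  by rewrite -[_ *: 1]/(c * 1) mulr1.
(* With l = a + i b, expC (- l * s) is E s * (k s - i * m s). *)
pose E s := expR (- a * s); pose k s := cos (b * s); pose m s := sin (b * s).
have DE s : is_derive s (1 : R) E (E s * - a).
  exact: (@is_derive1_comp _ expR (fun s => - a * s)).
have Dk s : is_derive s (1 : R) k (- m s * b).
  exact: (@is_derive1_comp _ cos (fun s => b * s)).
have Dn s : is_derive s (1 : R) m (k s * b).
  exact: (@is_derive1_comp _ sin (fun s => b * s)).
have HR : (E * (u * k + v * m)) 1 = (E * (u * k + v * m)) 0.
  apply: is_derive01_0_eq => s _; apply: is_derive_eq.
  rewrite -![_ *: _]/(_ * _) -![(_ + _) s]/(_ + _) -![(_ * _) s]/(_ * _).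
  ring.
have HI : (E * (v * k - u * m)) 1 = (E * (v * k - u * m)) 0.
  apply: is_derive01_0_eq => s _; apply: is_derive_eq.
  rewrite -![_ *: _]/(_ * _) -![(_ + _) s]/(_ + _) -![(_ * _) s]/(_ * _).
  rewrite -![(- _) s]/(- _) -![(_ * _) s]/(_ * _).
  ring.
have uvF r : u r +i* v r = F (r%:C * 1) by rewrite /u /v; case: (F _).
have {1}-> : (1 : C^o) = 1%:C * 1 by rewrite mulr1.
have -> : (0 : C^o) = 0%:C * 1 by rewrite mulr1.
rewrite -!uvF; apply/eqP; rewrite eq_complex /=; apply/andP; split; apply/eqP.
  move: HR; rewrite -[LHS]/(_ * (_ * _ + _ * _)) -[RHS]/(_ * (_ * _ + _ * _)).
  rewrite /E /k /m !mulr0 !mulr1 cos0 sin0 expR0 cosN sinN.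
  by rewrite mul1r mulr1 mulr0 addr0 => <-; ring.
move: HI; rewrite -[LHS]/(_ * (_ * _ - _ * _)) -[RHS]/(_ * (_ * _ - _ * _)).
rewrite /E /k /m !mulr0 !mulr1 cos0 sin0 expR0 cosN sinN.
by rewrite mul1r mulr1 mulr0 subr0 => <-; ring.
Qed.

End RealParts.


(** * Charts and smoothness of group translations *)

Lemma near_eq_is_diff (K : numFieldType) (V W : normedModType K) (f g df : V -> W) x :
  {near x, f =1 g} -> is_diff x f df -> is_diff x g df.
Proof.
move=> fg [dfx <-].
have E : g \o shift x = cst (g x) + 'd f x +o_ 0 id.
  apply/eqaddoP => _/posnumP[e]; have /eqaddoP/(_ e%:num [gt0 of e%:num]) := diff_locally dfx.
  apply: filter_app.
  have : \forall y \near (0 : V), f (y + x) = g (y + x).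
    have H : y + x @[y --> (0 : V)] --> x.
      by rewrite -{2}[x]add0r; apply: cvgD; [exact: cvg_id|exact: cvg_cst].
    exact: (H _ fg).
  apply: filter_app; near=> y => fgy.
  rewrite -![(_ + _ : _ -> _) _]/(_ + _) -![(- _ : _ -> _) _]/(- _) /cst /=.
  have fgx : f x = g x := nbhs_singleton fg.
  by rewrite fgx fgy.
have D : 'd g x = 'd f x :> (V -> W) by apply: diff_unique => //; exact: diff_continuous.
split => //; apply/diff_locallyP; split; first by rewrite D; exact: diff_continuous.
by rewrite D.
Unshelve. all: by end_near. Qed.

Section Charts.
Variables (K : numFieldType) (M : topologicalType) (E : normedModType K).
Variables (c : chart M E) (hc : chart_axiom c) (x : M) (cx : chart_dom c x).

Lemma chart_dom_nbhs : nbhs x (chart_dom c).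
Proof. by have [oc _ _ _ _] := hc; exact: open_nbhs_nbhs. Qed.

Lemma chart_mapK : chart_inv c (chart_map c x) = x.
Proof. by have [_ _ cK _ _] := hc; exact: cK. Qed.

Lemma chart_inv_cvg : chart_inv c u @[u --> chart_map c x] --> x.
Proof.
have [_ _ _ _ ci] := hc; rewrite -{2}chart_mapK; apply: ci.
by exists x.
Qed.

(** The image of a chart is open, so near the image of a point of its domain every
vector is the coordinate of a point of the domain. *)
Lemma chart_invK_near : \forall u \near chart_map c x,
  chart_dom c (chart_inv c u) /\ chart_map c (chart_inv c u) = u.
Proof.
have [_ oV cK _ _] := hc.
have : nbhs (chart_map c x) (chart_map c @` chart_dom c).
  by apply: open_nbhs_nbhs; split => //; exists x.
by apply: filterS => _ [y cy <-]; rewrite cK.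
Qed.

End Charts.

Section LieGroupAtlas.
Variables (K : numFieldType) (E : normedModType K) (G : groupTopologicalType).
Variables (A : set (chart G E)) (hA : lie_group_atlas A).

Let cA c : A c -> chart_axiom c.
Proof. by have [[_ _ + _ _] _ _] := hA; apply. Qed.

(** Pointwise form of [holomorphic] for self-maps of the group: translations are
composed one point at a time, through whatever chart contains the image. *)
Definition smooth_at (f : G -> G) (x : G) := {for x, continuous f} /\
  forall c d, A c -> A d -> chart_dom c x -> chart_dom d (f x) ->
    differentiable (chart_map d \o f \o chart_inv c) (chart_map c x).

(** The chart expressions of g and f through an intermediate chart m at f x compose
to that of g \o f only where f stays in the domain of m, whence the passage
through [near_eq_is_diff]. *)
Lemma smooth_at_comp (f g : G -> G) x :
  smooth_at f x -> smooth_at g (f x) -> smooth_at (g \o f) x.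
Proof.
move=> [fc fd] [gc gd]; split; first exact: continuous_comp.
move=> c d Ac Ad cx dgfx.
have [[_ _ _ cov _] _ _] := hA; have [m Am mfx] := cov (f x).
have d1 := fd c m Ac Am cx mfx; have d2 := gd m d Am Ad mfx dgfx.
have E1 : (chart_map m \o f \o chart_inv c) (chart_map c x) = chart_map m (f x).
  by rewrite /= (chart_mapK (cA Ac)).
have := differentiable_comp d1; rewrite E1 => /(_ _ _ d2) dd.
have H : \forall u \near chart_map c x, chart_dom m (f (chart_inv c u)).
  have : chart_inv c u @[u --> chart_map c x] --> x by exact: chart_inv_cvg (cA Ac) _ cx.
  move=> /cvg_comp /(_ fc); apply; exact: chart_dom_nbhs (cA Am) _ mfx.
suff : {near chart_map c x, (chart_map d \o g \o chart_inv m) \o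
    (chart_map m \o f \o chart_inv c) =1 chart_map d \o (g \o f) \o chart_inv c}.
  by move=> /near_eq_is_diff/(_ (differentiableP dd))[].
by apply: filterS H => u mu /=; rewrite (chart_mapK (cA Am)).
Qed.

Let mulD : holomorphic (prod_atlas A A) A (fun p : G * G => (p.1 * p.2)%g).
Proof. by have [] := hA. Qed.

Lemma cvg_mulg T (F : set_system T) {FF : Filter F} (f g : T -> G) a b :
  f @ F --> a -> g @ F --> b -> (f t * g t)%g @[t --> F] --> (a * b)%g.
Proof.
have [mc _] := mulD.
exact: (@continuous2_cvg _ _ _ _ _ _ _ _ (fun x y : G => (x * y)%g) _ _ (mc (a, b))).
Qed.

(** Freezing the first coordinate of a product chart at the image of a turns the
multiplication, read in charts, into the left translation by a. *)
Lemma smooth_at_mull (a x : G) : smooth_at (fun y => (a * y)%g) x.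
Proof.
have [mc md] := mulD; split.
  by apply: cvg_mulg; [exact: cvg_cst|exact: cvg_id].
move=> c d Ac Ad cx dax.
have [[_ _ _ cov _] _ _] := hA; have [m Am ma] := cov a.
have Apc : prod_atlas A A (prod_chart m c) by exists m => //; exists c.
have dm := md _ d (a, x) Apc Ad (conj ma cx) dax.
pose i (u : E) := (chart_map m a, u).
have di : differentiable i (chart_map c x).
  by apply: differentiable_pair; [exact: differentiable_cst|exact: ex_diff].
have := differentiable_comp di dm.
by congr (differentiable _ _); apply/funext => u /=; rewrite (chart_mapK (cA Am)).
Qed.

Lemma smooth_at_mulr (a x : G) : smooth_at (fun y => (y * a)%g) x.
Proof.
have [mc md] := mulD; split.
  by apply: cvg_mulg; [exact: cvg_id|exact: cvg_cst].
move=> c d Ac Ad cx dax.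
have [[_ _ _ cov _] _ _] := hA; have [m Am ma] := cov a.
have Apc : prod_atlas A A (prod_chart c m) by exists c => //; exists m.
have dm := md _ d (x, a) Apc Ad (conj cx ma) dax.
pose i (u : E) := (u, chart_map m a).
have di : differentiable i (chart_map c x).
  by apply: differentiable_pair; [exact: ex_diff|exact: differentiable_cst].
have := differentiable_comp di dm.
by congr (differentiable _ _); apply/funext => u /=; rewrite (chart_mapK (cA Am)).
Qed.

Lemma smooth_at_mullr (a b x : G) : smooth_at (fun y => (a * y * b)%g) x.
Proof.
exact: smooth_at_comp (smooth_at_mull a x) (smooth_at_mulr b _).
Qed.

Section AtOne.
Variables (c : chart G E) (Ac : A c) (c1 : chart_dom c 1%g).
Local Notation phi := (chart_map c).
Local Notation psi := (chart_inv c).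
Local Notation p := (phi 1%g).

(** The velocity is read in the fixed chart at 1, as the bracket of a Lie group is;
continuity keeps the curve in the domain of that chart near 0. *)
Definition tangent_curve (g : K^o -> G) (v : E) := [/\ g 0 = 1%g,
  {for (0 : K^o), continuous g} & is_derive (0 : K^o) (1 : K^o) (phi \o g) v].

Lemma tangent_curve_dom g v : tangent_curve g v ->
  \forall t \near (0 : K^o), chart_dom c (g t).
Proof.
move=> [g0 gc _]; have H : nbhs (g 0) (chart_dom c).
  by rewrite g0; exact: chart_dom_nbhs (cA Ac) _ c1.
exact: (gc _ H).
Qed.

(** The hypothesis that f 1 lies in the domain of the chart at 1 covers conjugations
as well as the small translations met along a curve through 1. *)
Lemma is_derive_smooth_curve (f : G -> G) g v :
  smooth_at f 1%g -> chart_dom c (f 1%g) -> tangent_curve g v ->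
  is_derive (0 : K^o) (1 : K^o) (phi \o f \o g) ('d (phi \o f \o psi) p v).
Proof.
move=> [_ fd] cf tg; have [g0 gc dg] := tg.
have := fd c c Ac Ac c1 cf => d1.
have := @is_derive_comp_diff _ _ _ (phi \o g) (phi \o f \o psi) 0 v dg.
rewrite /= g0 => /(_ d1); apply: near_eq_is_derive.
have := tangent_curve_dom tg.
by apply: filterS => t ct /=; rewrite (chart_mapK (cA Ac)).
Qed.

Lemma tangent_curve_rescale g v a :
  tangent_curve g v -> tangent_curve (fun t => g (a * t)) (a *: v).
Proof.
move=> [g0 gc dg]; split; first by rewrite mulr0.
  apply: (@continuous_comp _ _ _ (fun t : K^o => a * t : K^o) g).
    exact: (@scaler_continuous _ K^o).
  by rewrite mulr0.
by apply: (@is_derive_rescale _ _ (phi \o g)); rewrite mulr0.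
Qed.

(** At (1, 1) the differential of the multiplication is the sum, because it is the
identity on each factor: y * 1 = y and 1 * y = y. *)
Lemma tangent_curve_mul g h v w : tangent_curve g v -> tangent_curve h w ->
  tangent_curve (fun t => (g t * h t)%g) (v + w).
Proof.
move=> tg th; have [g0 gc dg] := tg; have [h0 hc dh] := th.
have [mc md] := mulD.
split; first by rewrite g0 h0 mulg1.
  by apply: (cvg_mulg (F := nbhs (0 : K^o)) gc hc).
have Apc : prod_atlas A A (prod_chart c c) by exists c => //; exists c.
have dm := md _ c (1%g, 1%g) Apc Ac (conj c1 c1).
rewrite /= mulg1 in dm; have {}dm := dm c1.
set m := (X in differentiable X _) in dm.
have ml : 'd m (p, p) (v, 0) = v.
  pose i (u : E) := (u, p).
  have di : is_diff p i (fun u => (u, 0)).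
    by apply: is_diff_pair.
  have dmi : is_diff p (m \o i) ('d m (p, p) \o (fun u => (u, 0))).
    by apply: is_diff_comp; exact: differentiableP.
  have : is_diff p id ('d m (p, p) \o (fun u => (u, 0))).
    apply: near_eq_is_diff dmi.
    have := chart_invK_near (cA Ac) c1; apply: filterS => u [cu uK].
    by rewrite /m /= (chart_mapK (cA Ac)) // mulg1.
  by case=> _ /(congr1 (fun f => f v)) /=; rewrite diff_val => <-.
have mr : 'd m (p, p) (0, w) = w.
  pose i (u : E) := (p, u).
  have di : is_diff p i (fun u => (0, u)).
    by apply: is_diff_pair.
  have dmi : is_diff p (m \o i) ('d m (p, p) \o (fun u => (0, u))).
    by apply: is_diff_comp; exact: differentiableP.
  have : is_diff p id ('d m (p, p) \o (fun u => (0, u))).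
    apply: near_eq_is_diff dmi.
    have := chart_invK_near (cA Ac) c1; apply: filterS => u [cu uK].
    by rewrite /m /= (chart_mapK (cA Ac)) // mul1g.
  by case=> _ /(congr1 (fun f => f w)) /=; rewrite diff_val => <-.
have dgh : is_derive (0 : K^o) (1 : K^o) (fun t => (phi (g t), phi (h t))) (v, w).
  case: dg dh => /derivable1_diffP dg <- [/derivable1_diffP dh <-].
  have dp := differentiable_pair dg dh.
  split; first exact/derivable1_diffP.
  by rewrite deriveE // diff_pair //= -!deriveE.
have := @is_derive_comp_diff _ _ _ _ m 0 _ dgh; rewrite g0 h0 => /(_ dm).
have -> : (v, w) = (v, 0) + (0, w) by rewrite -[RHS]/(v + 0, 0 + w) addr0 add0r.
rewrite linearD ml mr; apply: near_eq_is_derive.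
near=> t; rewrite /m /= !(chart_mapK (cA Ac)) //.
- by near: t; exact: tangent_curve_dom th.
- by near: t; exact: tangent_curve_dom tg.
Unshelve. all: by end_near. Qed.

End AtOne.
End LieGroupAtlas.


(** * Adjoint action, one-parameter subgroups and the exponential *)

Section LieGroups.
Variables (R : realType).
Local Notation C := R[i].
Variables (L : vectType C) (br : lieBracket L) (G : lieGroup br).
Local Notation c := (lg_chart1 G).
Local Notation phi := (chart_map c).
Local Notation psi := (chart_inv c).
Local Notation p := (phi 1%g).
Local Notation theta := (lg_tangent G).
Local Notation A := (lg_atlas G).
Local Notation n := (lg_dim G).

Let hA : lie_group_atlas A := lg_atlasP G.
Let Ac : A c := lg_chart1P G.
Let c1 : chart_dom c 1%g := lg_chart1_1 G.
Let hc : chart_axiom c.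
Proof. by have [[_ _ + _ _] _ _] := hA; apply. Qed.
Local Notation tangent_curve := (@tangent_curve C _ G c).

Lemma thetaK : cancel theta (theta^-1)%VF.
Proof.
move=> Y; apply: lker0_lfunK; apply/lker0P.
exact: bij_inj (lg_tangent_bij G).
Qed.

Lemma thetaVK : cancel (theta^-1)%VF theta.
Proof.
move=> u; have [f _ fK] := lg_tangent_bij G.
by rewrite -[u]fK thetaK.
Qed.

Lemma theta_Ad x Y : theta (Ad x Y) =
  'd (phi \o (fun y : G => (x * y * x^-1)%g) \o psi : 'rV[C]_n -> 'rV[C]_n) p (theta Y).
Proof. by rewrite /Ad /adjoint !comp_lfunE thetaVK lfunE. Qed.

Lemma tangent_curve_conj x (g : C^o -> G) Y : tangent_curve g (theta Y) ->
  tangent_curve (fun t => (x * g t * x^-1)%g) (theta (Ad x Y)).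
Proof.
move=> tg; have [g0 gc dg] := tg; split; first by rewrite g0 mulg1 mulgV.
  have := (smooth_at_mullr hA x (x^-1)%g 1%g).1; rewrite -g0.
  exact: continuous_comp.
have s := smooth_at_mullr hA x (x^-1)%g 1%g.
by rewrite theta_Ad; apply: (is_derive_smooth_curve hA Ac c1 s _ tg); rewrite /= mulg1 mulgV.
Qed.

Lemma tangent_curve_unique g v w : tangent_curve g v -> tangent_curve g w -> v = w.
Proof. by move=> [_ _ [_ <-]] [_ _ [_ <-]]. Qed.

Definition one_param (g : C^o -> G) :=
  forall s t, g (s + t) = (g s * g t)%g.

Lemma one_paramN g t : one_param g -> g (- t) = ((g t)^-1)%g.
Proof.
move=> hg; have g0 : g 0 = 1%g.
  by apply: (mulgI (g 0)); rewrite -hg addr0 mulg1.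
by apply: (mulgI (g t)); rewrite -hg subrr g0 mulgV.
Qed.

Lemma one_paramMn g t k : one_param g -> g (t *+ k) = (g t ^+ k)%g.
Proof.
move=> hg; elim: k => [|k IH]; last by rewrite mulrS hg IH expgS.
by rewrite mulr0n; apply: (mulgI (g 0)); rewrite -hg addr0 mulg1.
Qed.

(** The curve f(t) = g1(t) g2(-t) has velocity v - v = 0 at t = 0.  Since
f(t0 + t) = g1(t0) f(t) g2(-t0), its velocity vanishes wherever it stays in the
chart at 1, so it is constant there. *)
Lemma one_param_near_unique g1 g2 v : one_param g1 -> one_param g2 ->
  tangent_curve g1 v -> tangent_curve g2 v ->
  exists2 d : R, 0 < d & forall w : C, `|w| < d%:C%C -> g1 w = g2 w.
Proof.
move=> h1 h2 t1 t2.
pose f t := (g1 t * g2 (- 1 * t)%R)%g.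
have tf : tangent_curve f 0.
  rewrite -(subrr v) -[X in _ + X]scaleN1r.
  exact: tangent_curve_mul hA _ Ac c1 _ _ _ _ t1 (tangent_curve_rescale _ t2).
have [/= r r0 Hr] := (nbhs_ballP _ _).1 (tangent_curve_dom hA Ac c1 tf).
have rE : r = (complex.Re r)%:C%C by rewrite RRe_real// gtr0_real.
(* Radii of balls over R[i] are complex numbers; a positive one is real. *)
exists (complex.Re r); first by rewrite -ltcR -rE.
move=> w; rewrite -rE => wr.
have f0 : f 0 = 1%g by have [] := tf.
have phif : phi (f w) = phi (f 0).
  apply: (eq_of_derive0_rV (F := phi \o f)) => s s01.
  have sw : chart_dom c (f (s%:C%C * w)).
    apply: Hr; rewrite /ball /= sub0r normrN normrM.
    apply: le_lt_trans wr; rewrite ler_piMl //.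
    have /andP[s0 s1] := s01.
    by rewrite ger0_norm ?ler0c // -[1]/(1%:C%C) lecR.
  apply: is_derive_translate.
  set t0 := s%:C%C * w.
  have E : (fun t : C^o => (phi \o f) (t0 + t)) =
      phi \o (fun y : G => (g1 t0 * y * g2 (- t0)%R)%g) \o f.
    apply/funext => t /=; congr phi; rewrite /f.
    by rewrite !mulN1r opprD [- t0 - t]addrC h1 h2 !mulgA.
  rewrite E.
  have sm := smooth_at_mullr hA (g1 t0) (g2 (- t0)) 1%g.
  have := is_derive_smooth_curve hA Ac c1 sm _ tf.
  rewrite linear0; apply; rewrite mulg1.
  by move: sw; rewrite /f mulN1r.
have fw : f w = 1%g.
  rewrite -[LHS](chart_mapK hc); first by rewrite phif f0 (chart_mapK hc).
  by apply: Hr; rewrite /ball /= sub0r normrN.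
move: fw; rewrite /f mulN1r one_paramN // => fw.
by apply: (mulIg (g2 w)^-1%g); rewrite fw mulgV.
Qed.

(** Any w is a multiple w = k (w / k) of a vector so small that the two subgroups
agree on it. *)
Lemma one_param_unique g1 g2 v : one_param g1 -> one_param g2 ->
  tangent_curve g1 v -> tangent_curve g2 v -> g1 =1 g2.
Proof.
move=> h1 h2 t1 t2 w.
have [d d0 Hd] := one_param_near_unique h1 h2 t1 t2.
pose r := complex.Re `|w|.
have rE : `|w| = r%:C%C by rewrite RRe_real.
pose k := (Num.truncn (r / d)).+1.
have k0 : (k%:R : C) != 0 by rewrite pnatr_eq0.
have wk : w = (w / k%:R) *+ k by rewrite -mulr_natr divfK.
rewrite wk !one_paramMn //; congr (_ ^+ _)%g; apply: Hd.
rewrite normrM normfV normr_nat ltr_pdivrMr ?ltr0n // rE.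
rewrite -[k%:R](rmorph_nat (real_complex R)) -rmorphM ltcR mulrC -ltr_pdivrMr //.
exact: truncnS_gt.
Qed.

Section Exponential.
Variables (Exp : L -> G) (hExp : is_exponential Exp).

Lemma Exp_one_param X : one_param (fun t : C^o => Exp (t *: X)).
Proof. by have [] := hExp X. Qed.

Lemma Exp0 : Exp 0 = 1%g.
Proof.
by have := one_paramMn 0 0 (Exp_one_param 0); rewrite /= scaler0 expg0.
Qed.

Lemma Exp_tangent X : tangent_curve (fun t : C^o => Exp (t *: X)) (theta X).
Proof.
have [[ec _] _ d] := hExp X; split => //; first by rewrite scale0r Exp0.
exact: ec.
Qed.

Lemma ExpN X : Exp (- X) = ((Exp X)^-1)%g.
Proof.
by have := one_paramN 1 (Exp_one_param X); rewrite /= scaleN1r scale1r.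
Qed.

(** Every Y is the velocity of the curve t |-> Exp (t Y), whose conjugate by x * y is
its successive conjugate by y and x; comparing velocities gives the result. *)
Lemma AdM x y Y : Ad (x * y)%g Y = Ad (G := G) x (Ad y Y).
Proof.
apply: (bij_inj (lg_tangent_bij G)).
have t1 := tangent_curve_conj (x * y)%g (Exp_tangent Y).
have t2 := tangent_curve_conj x (tangent_curve_conj y (Exp_tangent Y)).
apply: tangent_curve_unique t1 _.
suff -> : (fun t : C^o => (x * y * Exp (t *: Y) * (x * y)^-1)%g) =
  fun t => (x * (y * Exp (t *: Y) * y^-1) * x^-1)%g by [].
by apply/funext => t; rewrite invgM !mulgA.
Qed.

Lemma Ad1 Y : Ad (G := G) 1%g Y = Y.
Proof.
apply: (bij_inj (lg_tangent_bij G)).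
apply: tangent_curve_unique (Exp_tangent Y).
have := tangent_curve_conj 1%g (Exp_tangent Y).
by congr tangent_curve; apply/funext => t; rewrite mul1g invg1 mulg1.
Qed.

Lemma Exp_Ad x Y : (x * Exp Y * x^-1)%g = Exp (Ad x Y).
Proof.
rewrite -[Y in LHS]scale1r -[Ad x Y]scale1r.
apply: (@one_param_unique (fun t : C^o => (x * Exp (t *: Y) * x^-1)%g)
  (fun t : C^o => Exp (t *: Ad x Y)) (theta (Ad x Y))).
- by move=> s t; rewrite Exp_one_param !mulgA mulgVK.
- exact: Exp_one_param.
- exact: tangent_curve_conj (Exp_tangent Y).
- exact: Exp_tangent.
Qed.

(** At t = 0 this is the defining property of the bracket of the Lie group; at other
times Ad (Exp ((t + s) X)) = Ad (Exp (t X)) Ad (Exp (s X)) and Ad (Exp (t X)) is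
linear. *)
Lemma is_derive_Ad_Exp X Y t :
  is_derive (t : C^o) (1 : C^o) (fun s : C^o => theta (Ad (Exp (s *: X)) Y))
    (theta (Ad (Exp (t *: X)) (br X Y))).
Proof.
apply: is_derive_translate.
have [e0 _ dX] := Exp_tangent X.
have dB := lg_bracketP G Y.
set B := (fun u => theta _) in dB.
have d1 : is_derive (0 : C^o) (1 : C^o) (fun s : C^o => theta (Ad (Exp (s *: X)) Y))
   (theta (br X Y)).
  have := @is_derive_comp_diff _ _ _ _ B 0 _ dX.
  rewrite /= scale0r Exp0 => /(_ (@ex_diff _ _ _ _ _ _ _ dB)).
  have -> := @diff_val _ _ _ _ _ _ _ dB; rewrite thetaK.
  apply: near_eq_is_derive.
  have := tangent_curve_dom hA Ac c1 (Exp_tangent X).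
  by apply: filterS => s cs; rewrite /B /= (chart_mapK hc).
set x := Exp (t *: X).
have [_ dx] := smooth_at_mullr hA x (x^-1)%g 1%g.
have {}dx := dx c c Ac Ac c1.
rewrite mulg1 mulgV in dx; have {}dx := dx c1.
have cd := diff_continuous dx.
have dD := is_derive_linear cd d1.
rewrite -/x -theta_Ad in dD.
suff <- : (fun s : C^o => theta (Ad x (Ad (Exp (s *: X)) Y))) =
    (fun s : C^o => theta (Ad (Exp ((t + s) *: X)) Y)).
  by move: dD; congr is_derive; apply/funext => s; exact/esym/theta_Ad.
apply/funext => s; have E : Exp ((t + s) *: X) = (x * Exp (s *: X))%g.
  exact: Exp_one_param.
have H := (etrans (esym (AdM x _ Y)) (congr1 (fun z => Ad z Y) (esym E))).
exact: (congr1 theta H).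
Qed.

(** Each coordinate F of Ad (Exp (s X)) Y satisfies F' = l F. *)
Lemma Ad_Exp_eigen X Y l : br X Y = l *: Y -> Ad (Exp X) Y = expC l *: Y.
Proof.
move=> XY; apply: (bij_inj (lg_tangent_bij G)).
rewrite linearZ /=; apply/rowP => j; rewrite mxE.
have Hd t : is_derive (t : C^o) (1 : C^o)
    (fun s : C^o => theta (Ad (Exp (s *: X)) Y) ord0 j : C^o)
    (l * theta (Ad (Exp (t *: X)) Y) ord0 j).
  have := is_derive_coord j (is_derive_Ad_Exp X Y t).
  have -> // : theta (Ad (Exp (t *: X)) (br X Y)) ord0 j =
      l * theta (Ad (Exp (t *: X)) Y) ord0 j.
  move: (Exp (t *: X)) => x.
  by rewrite XY [Ad x _]linearZ [theta _]linearZ mxE.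
have e1 : Ad (Exp ((1 : C) *: X)) Y = Ad (Exp X) Y by congr (Ad (Exp _) Y); exact: scale1r.
have e0 : Ad (Exp ((0 : C) *: X)) Y = Y.
  by rewrite -[RHS]Ad1 -Exp0; congr (Ad (Exp _) Y); exact: scale0r.
pose f Z := theta Z ord0 j.
have H : f (Ad (Exp ((1 : C) *: X)) Y) = expC l * f (Ad (Exp ((0 : C) *: X)) Y).
  exact: (expC_ode Hd).
exact: etrans (congr1 f (esym e1)) (etrans H (congr1 (fun Z => expC l * f Z) e0)).
Qed.

End Exponential.
End LieGroups.


(** * Common eigenvectors and Lie brackets *)

Lemma linfunE (K : fieldType) (U V : vectType K) (f : U -> V) :
  linear f -> linfun f =1 f.
Proof.
move=> fl; pose fM := GRing.isLinear.Build _ _ _ _ _ fl.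
pose fL : {linear U -> V} := HB.pack f fM.
by move=> u; rewrite -[f in linfun f]/(fL : U -> V) lfunE.
Qed.

Section CommonEigenvector.
Variables (K : numClosedFieldType) (V : vectType K).

Lemma stable_eigenvector (W : {vspace V}) (f : 'End(V)) :
  W != 0%VS -> (f @: W <= W)%VS ->
  exists a, exists2 v, v != 0 & v \in W /\ f v = a *: v.
Proof.
move=> W0 fW; pose b := vbasis W.
pose A : 'M[K]_(\dim W) := \matrix_(i, j) coord b j (f b`_i).
have [|a /eigenvalueP[x xA x0]] := spectral.eigenvalue_closed A.
  by rewrite lt0n dimv_eq0.
have fb (i : 'I_(\dim W)) : f b`_i = \sum_j A i j *: b`_j.
  have : f b`_i \in W.
    apply: (subvP fW); apply: memv_img.
    by apply: vbasis_mem; rewrite mem_nth // size_tuple.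
  move/coord_vbasis => ->; apply: eq_bigr => j _; by rewrite mxE.
exists a; exists (\sum_i x ord0 i *: b`_i).
  apply: contra_neq x0 => E; apply/rowP => i; rewrite mxE.
  by have /freeP := basis_free (vbasisP W); apply.
split.
  apply: memv_suml => i _; apply: memvZ.
  by apply: vbasis_mem; rewrite mem_nth // size_tuple.
rewrite linear_sum scaler_sumr.
under eq_bigr => i _ do rewrite linearZ /= fb scaler_sumr.
rewrite exchange_big /=; apply: eq_bigr => j _.
have /rowP/(_ j) := xA; rewrite !mxE => E.
by rewrite scalerA -E scaler_suml; apply: eq_bigr => i _; rewrite scalerA.
Qed.

(** Induction on the list: an eigenspace of the first map within W is stable under
the others, because they commute with it. *)
Lemma common_eigenvector_stable (fs : seq 'End(V)) (W : {vspace V}) :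
  W != 0%VS -> (forall f, f \in fs -> (f @: W <= W)%VS) ->
  (forall f g v, f \in fs -> g \in fs -> f (g v) = g (f v)) ->
  exists2 v, v != 0 & v \in W /\ forall f, f \in fs -> exists a, f v = a *: v.
Proof.
elim: fs W => [|f fs IH] W W0 sW cW.
  exists (vpick W); first by rewrite vpick0.
  by split; [exact: memv_pick|].
have [a [v v0 [vW fv]]] := stable_eigenvector W0 (sW f (mem_head _ _)).
pose W' := (W :&: lker (f - a *: \1%VF))%VS.
have W'P u : u \in W' = (u \in W) && (f u == a *: u).
  by rewrite memv_cap memv_ker !lfun_simp subr_eq0.
have vW' : v \in W' by rewrite W'P vW fv eqxx.
have [||g g' u hg hg'|w w0 [wW' we]] := IH W'.
- by apply: contra_neq v0 => E; apply/eqP; rewrite -memv0 -E.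
- move=> g hg; apply/subvP => _ /memv_imgP[u uW' ->].
  move: uW'; rewrite !W'P => /andP[uW /eqP fu].
  have gfs : g \in f :: fs by rewrite inE hg orbT.
  rewrite (subvP (sW g gfs)) ?memv_img //=.
  by rewrite (cW f g) ?mem_head // fu linearZ.
- by apply: cW; rewrite inE ?hg ?hg' orbT.
exists w => //; move: wW'; rewrite W'P => /andP[wW /eqP fw]; split => //.
by move=> g; rewrite inE => /predU1P[->|/we //]; exists a.
Qed.

End CommonEigenvector.

Section Brackets.
Variables (K : fieldType) (L : vectType K) (br : lieBracket L).

Lemma lie_linear x : linear (br x).
Proof. by move=> a u v; rewrite lie_linr. Qed.

Lemma linear_lie x : linear (br ^~ x).
Proof. by move=> a u v; rewrite lie_linl. Qed.

Definition ad x : 'End(L) := linfun (br x).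

Lemma adE x y : ad x y = br x y.
Proof. exact/linfunE/lie_linear. Qed.

Lemma lieD x y z : br x (y + z) = br x y + br x z.
Proof. by rewrite -!adE linearD. Qed.

Lemma lieZ a x y : br x (a *: y) = a *: br x y.
Proof. by rewrite -!adE linearZ. Qed.

Lemma lieDl x y z : br (x + y) z = br x z + br y z.
Proof. by have := linear_lie z 1 x y; rewrite !scale1r. Qed.

Lemma lie0l z : br 0 z = 0.
Proof. by apply: (addrI (br 0 z)); rewrite -lieDl !addr0. Qed.

Lemma lieZl a x y : br (a *: x) y = a *: br x y.
Proof. by have := linear_lie y a x 0; rewrite !addr0 lie0l addr0. Qed.

Lemma lieC x y : br x y = - br y x.
Proof.
apply/eqP; rewrite -addr_eq0; have := lie_alt br (x + y).
by rewrite lieDl !lieD !lie_alt add0r addr0 => ->.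
Qed.

Lemma lie_der x y z : br x (br y z) = br (br x y) z + br y (br x z).
Proof.
have := lie_jacobi br x y z.
rewrite (lieC z (br x y)) (lieC z x) -(adE y (- _)) linearN /= adE => /eqP.
by rewrite -addrA -opprD subr_eq0 => /eqP ->; rewrite addrC.
Qed.

End Brackets.


(** * Exponentials of elements of a Cartan subalgebra *)

Section CartanExponentials.
Variables (R : realType).
Local Notation C := R[i].
Variables (L : vectType C) (br : lieBracket L) (G : lieGroup br).
Variables (Exp : L -> G) (hExp : is_exponential Exp).
Local Notation theta := (lg_tangent G).

(** Ad (Exp X) fixes Y, being multiplication by expC 0 on it, so conjugation by Exp X
fixes Exp Y. *)
Lemma Exp_commute X Y : br X Y = 0 -> (Exp X * Exp Y = Exp Y * Exp X)%g.
Proof.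
move=> XY.
have AdY : Ad (Exp X) Y = Y.
  by rewrite (@Ad_Exp_eigen _ _ _ _ _ hExp X Y 0) ?scale0r // expC0 scale1r.
have := Exp_Ad hExp (Exp X) Y; rewrite AdY => H.
by rewrite -[RHS](congr1 (fun z => (z * Exp X)%g) H) mulgVK.
Qed.

(** The product t |-> Exp (t X) Exp (t Y) is a one-parameter subgroup because its
factors commute, and its velocity is X + Y. *)
Lemma ExpD X Y : br X Y = 0 -> Exp (X + Y) = (Exp X * Exp Y)%g.
Proof.
move=> XY.
have cXY (s t : C) : (Exp (s *: X) * Exp (t *: Y) = Exp (t *: Y) * Exp (s *: X))%g.
  by apply: Exp_commute; rewrite lieZ lieZl XY !scaler0.
pose g (t : C^o) := (Exp (t *: X) * Exp (t *: Y))%g.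
have hg : one_param g.
  move=> s t; rewrite /g (Exp_one_param hExp X s t) (Exp_one_param hExp Y s t).
  by rewrite /= !mulgA -(mulgA (Exp (s *: X))) cXY !mulgA.
have tg : tangent_curve (lg_chart1 G) g (theta (X + Y)).
  have := tangent_curve_mul (lg_atlasP G) (lg_chart1P G) (lg_chart1_1 G)
    (Exp_tangent hExp X) (Exp_tangent hExp Y).
  by rewrite linearD.
have := one_param_unique (Exp_one_param hExp (X + Y)) hg (Exp_tangent hExp (X + Y)) tg.
move/(_ 1); rewrite /g /=.
have E Z : Exp ((1 : C) *: Z) = Exp Z by congr Exp; exact: scale1r.
by move=> H; apply: etrans (esym (E _)) (etrans H _); congr (_ * _)%g; exact: E.
Qed.

(** An element acting trivially by Ad centralizes the image of Exp.  That centralizer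
K is normal, since conjugation permutes the exponentials.  If it were G, then
Ad (Exp (t X)) Y would be constant in t and its derivative [X, Y] would vanish. *)
Lemma eq1_of_Ad_id (z : G) : simple_group G -> ~ lie_abelian br fullv ->
  (forall Y, Ad z Y = Y) -> z = 1%g.
Proof.
move=> [_ sG] nab zE.
pose K := [set y : G | forall Y, (y * Exp Y = Exp Y * y)%g].
have subK : subgroup_set K.
  split=> [Y|x y Kx Ky Y|x Kx Y]; first by rewrite mul1g mulg1.
    by rewrite -mulgA Ky mulgA Kx mulgA.
  by apply: (mulgI x); apply: (mulIg x); rewrite !mulgA mulgV mul1g mulgVK Kx.
have normK : normal_set K.
  split => // x y Ky Y.
  have E : Exp Y = (x * Exp (Ad x^-1%g Y) * x^-1)%g.
    by rewrite (Exp_Ad hExp) -(AdM hExp) mulgV (Ad1 hExp).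
  by rewrite E !mulgA !mulgVK -!mulgA; congr (x * _)%g; rewrite !mulgA Ky.
have Kz : K z.
  by move=> Y; have := Exp_Ad hExp z Y; rewrite zE => H; rewrite -{2}H mulgVK.
have [K1|KT] := sG K normK; first by move: Kz; rewrite K1.
case: nab => X Y _ _.
have AdE t : Ad (Exp (t *: X)) Y = Y.
  apply: (bij_inj (lg_tangent_bij G)).
  have Kt : K (Exp (t *: X)) by rewrite KT.
  apply: (tangent_curve_unique _ (Exp_tangent hExp Y)).
  have := tangent_curve_conj (Exp (t *: X)) (Exp_tangent hExp Y).
  congr tangent_curve; apply/funext => s.
  by rewrite Kt mulgK.
have d := is_derive_Ad_Exp hExp X Y 0.
apply: (bij_inj (lg_tangent_bij G)).
have d0 : is_derive (0 : C^o) (1 : C^o) (fun s : C^o => theta (Ad (Exp (s *: X)) Y)) 0.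
  have -> : (fun s : C^o => theta (Ad (Exp (s *: X)) Y)) = cst (theta Y).
    by apply/funext => s; rewrite AdE.
  exact: is_derive_cst.
have E0 : theta (Ad (Exp ((0 : C) *: X)) (br X Y)) = theta (br X Y).
  rewrite (_ : Exp _ = 1%g) ?(Ad1 hExp) // -(Exp0 hExp).
  by congr Exp; exact: scale0r.
rewrite linear0; case: d => _ d; case: d0 => _ d0.
exact: etrans (esym E0) (etrans (esym d) d0).
Qed.

Variables (h : {vspace L}) (hcartan : cartan_subalgebra br h).
Variables (N : nat) (alpha : 'I_N -> hdual h) (halpha : simple_system br alpha).

(** The eigenspace of ad Z for l is stable under the commuting maps ad x, for x in h,
so it contains a common eigenvector w.  The eigenvalues of h on w form a linear
form a with a Z = l, and w is a root vector for it unless a = 0. *)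
Lemma ad_eigenvalue_weight (Z : subvs_of h) (l : C) (v : L) : v != 0 ->
  br (vsval Z) v = l *: v -> exists2 a : hdual h, a Z = l & a = 0 \/ is_root br a.
Proof.
have [hab _ _] := hcartan.
move=> v0 Zv; pose z := vsval Z.
have zh : z \in h by exact: subvsP.
pose W := lker (ad br z - l *: \1%VF).
have WP u : (u \in W) = (br z u == l *: u).
  by rewrite memv_ker !lfun_simp subr_eq0 adE.
have vW : v \in W by rewrite WP Zv.
have comm x y u : x \in h -> y \in h -> br x (br y u) = br y (br x u).
  by move=> xh yh; rewrite lie_der (hab x y xh yh) lie0l add0r.
have [|||w w0 [wW we]] := @common_eigenvector_stable _ _ [seq ad br x | x <- vbasis h] W.
- by apply: contra_neq v0 => E; apply/eqP; rewrite -memv0 -E.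
- move=> _ /mapP[x /vbasis_mem xh ->]; apply/subvP => _ /memv_imgP[u uW ->].
  by move: uW; rewrite adE !WP => /eqP E; rewrite comm // E lieZ.
- move=> _ _ u /mapP[x /vbasis_mem xh ->] /mapP[y /vbasis_mem yh ->].
  by rewrite !adE comm.
have wt x : x \in h -> exists a, br x w = a *: w.
  move=> xh; rewrite (coord_vbasis xh).
  have bi (i : 'I_(\dim h)) : exists a, br (vbasis h)`_i w = a *: w.
    rewrite -adE; apply: we; apply: map_f; apply: mem_nth.
    by rewrite size_tuple.
  elim/big_ind: _ => [|x1 x2 [a1 e1] [a2 e2]|i _]; first by exists 0; rewrite lie0l scale0r.
    by exists (a1 + a2); rewrite lieDl e1 e2 scalerDl.
  by have [a e] := bi i; exists (coord (vbasis h) i x * a); rewrite lieZl e scalerA.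
(* Reading off the coefficient along w makes the eigenvalue a linear function. *)
pose fw := fun H : subvs_of h => coord [tuple w] ord0 (br (vsval H) w) : C^o.
have cw (b : C) : coord [tuple w] ord0 (b *: w) = b.
  have := @coord_free _ _ _ [tuple w] ord0 ord0; rewrite seq1_free w0 => /(_ isT) E.
  by rewrite linearZ /= E eqxx mulr1.
have fwl : linear fw.
  move=> a x y; by rewrite /fw !linearP /= lie_linl linearP.
pose a : hdual h := linfun fw.
have aE H : a H = fw H by exact: linfunE.
have rs : root_space br a w.
  by move=> H; rewrite aE /fw; have [b ->] := wt _ (subvsP H); rewrite cw.
exists a.
  by rewrite aE /fw; move: wW; rewrite WP => /eqP ->; rewrite cw.
have [->|a0] := eqVneq a 0; first by left.
by right; split => //; exists w.
Qed.

Lemma expC_nat_comb (b : hdual h) (Z : subvs_of h) : nat_comb alpha b ->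
  (forall k, expC (alpha k Z) = 1) -> expC (b Z) = 1.
Proof.
move=> [m ->] hZ; rewrite sum_lfunE.
elim/big_ind: _ => [|x y ex ey|i _]; first exact: expC0.
  by rewrite expCD ex ey mulr1.
elim: (m i) => [|k IH]; first by rewrite mulr0n zero_lfunE; exact: expC0.
by rewrite mulrS add_lfunE expCD IH hZ mulr1.
Qed.

Lemma Ad_Exp_id (Z : subvs_of h) : (forall k, expC (alpha k Z) = 1) ->
  forall Y, Ad (Exp (vsval Z)) Y = Y.
Proof.
move=> hZ Y.
have [_ _ hss] := hcartan.
have [b bb be] := hss _ (subvsP Z).
have : Y \in <<b>>%VS by rewrite (span_basis bb) memvf.
suff : (<<b>> <= lker (Ad (G := G) (Exp (vsval Z)) - \1%VF))%VS.
  move=> /subvP/[apply]; rewrite memv_ker add_lfunE opp_lfunE id_lfunE subr_eq0.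
  by move/eqP.
apply/span_subvP => v vb; rewrite memv_ker add_lfunE opp_lfunE id_lfunE subr_eq0; apply/eqP.
have [l lv] := be v vb.
have v0 : v != 0 by exact: free_not0 (basis_free bb) vb.
rewrite (Ad_Exp_eigen hExp lv).
suff -> : expC l = 1 by rewrite scale1r.
have [a <- [->|ra]] := ad_eigenvalue_weight v0 lv.
  by rewrite zero_lfunE; exact: expC0.
have [_ _ hr] := halpha.
have [pa|na] := hr a ra; first exact: expC_nat_comb.
have := expC_nat_comb na hZ; rewrite opp_lfunE => E.
by have := expCN (a Z); rewrite E mulr1.
Qed.

End CartanExponentials.

(** * The Cartan subgroup and equivariance *)

Section Equivariance.
Variables (R : realType).
Local Notation C := R[i].
Variables (L : vectType C) (br : lieBracket L) (G : lieGroup br).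
Variables (Exp : L -> G) (hExp : is_exponential Exp).
Variables (h : {vspace L}) (hcartan : cartan_subalgebra br h).
Variables (N : nat) (alpha : 'I_N -> hdual h) (halpha : simple_system br alpha).

(** Since h is abelian, its exponentials already form a subgroup. *)
Lemma integral_subgroupE x : integral_subgroup Exp h x <-> exists2 X, X \in h & x = Exp X.
Proof.
have [hab _ _] := hcartan; split; last first.
  by case=> X Xh ->; move=> K _; apply; exists X.
move=> /(_ [set x | exists2 X, X \in h & x = Exp X]); apply; last first.
  by move=> _ [X /= Xh <-]; exists X.
split; first by exists 0; rewrite ?mem0v ?(Exp0 hExp).
- move=> _ _ [X Xh ->] [Y Yh ->]; exists (X + Y); first exact: memvD.
  by rewrite (ExpD hExp) // hab.
- by move=> _ [X Xh ->]; exists (- X); rewrite ?memvN // (ExpN hExp).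
Qed.

Variables (hh : hdual h -> subvs_of h) (M : 'M[C]_N).
Hypothesis hM : cartan_matrix alpha hh *m M = 1%:M.

(** The coefficient of x_j is sum_i M_ji A_ik = (M A)_jk, and M is also a left inverse
of the Cartan matrix A. *)
Lemma simple_root_dual_sum (x : 'I_N -> C) k :
  alpha k (\sum_i \sum_j (M j i * x j) *: hh (alpha i)) = x k.
Proof.
have hM' := mulmx1C hM.
rewrite linear_sum /=.
under eq_bigr => i _ do rewrite linear_sum /=.
rewrite exchange_big /=.
rewrite (bigD1 k) //= [X in _ + X]big1 ?addr0 => [|j jk].
  under eq_bigr => i _ do rewrite linearZ /=.
  transitivity ((M *m cartan_matrix alpha hh) k k * x k); last first.
    by rewrite hM' mxE eqxx mul1r.
  rewrite mxE mulr_suml; apply: eq_bigr => i _; rewrite mxE.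
  by rewrite -[_ *: _]/(_ * _) mulrAC.
under eq_bigr => i _ do rewrite linearZ /=.
transitivity ((M *m cartan_matrix alpha hh) j k * x j); last first.
  by rewrite hM' mxE (negbTE jk) mul0r.
rewrite mxE mulr_suml; apply: eq_bigr => i _; rewrite mxE.
by rewrite -[_ *: _]/(_ * _) mulrAC.
Qed.

End Equivariance.

Theorem theorem5p1 (R : realType)
  (L : vectType R[i]) (br : lieBracket L) (Lsimple : lie_simple br)
  (h : {vspace L}) (hcartan : cartan_subalgebra br h)
  (N : nat) (hN : (\dim h)%VS = N)
  (alpha : 'I_N -> hdual h) (halpha : simple_system br alpha)
  (e : hdual h -> L) (he : dual_root_vectors br alpha e)
  (hh : hdual h -> subvs_of h)
  (hhh : forall a : hdual h, is_root br a -> is_coroot br a (hh a))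
  (C : 'M[R[i]]_N) (hC : cartan_matrix alpha hh *m C = 1%:M)
  (G : lieGroup br) (Gsimple : simple_group G)
  (Exp : L -> G) (hExp : is_exponential Exp)
  (log : R[i]^o -> R[i]^o) (hlog : log_branch log) :
  let H : set G := integral_subgroup Exp h in
  let U : set 'Hom(L, R[i]^o) := Uset alpha e in
  let g : 'Hom(L, R[i]^o) -> G := gmap Exp alpha e hh C log in
  (forall xi, U xi -> H (g xi)) /\
  (forall x xi, H x -> U xi ->
     U (Ad_star (x^-1)%g xi) /\ g (Ad_star (x^-1)%g xi) = (x * g xi)%g).
Proof.
move=> H U g.
pose P (x : 'I_N -> R[i]) := \sum_i \sum_j (C j i * x j) *: hh (alpha i).
pose lg xi j := log (root_coord e xi (alpha j)).
have gE xi : g xi = Exp (vsval (P (lg xi))).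
  rewrite /g /gmap /P /=; congr Exp; rewrite linear_sum /=; apply: eq_bigr => i _.
  by rewrite linear_sum /=; apply: eq_bigr => j _; exact: (esym (linearZ _ _)).
have [hab _ _] := hcartan.
split=> [xi _|x xi].
  by apply/(integral_subgroupE hExp hcartan); exists (vsval (P (lg xi))) => //; exact: subvsP.
move=> /(integral_subgroupE hExp hcartan)[X0 X0h ->] xiU.
pose X : subvs_of h := vsproj h X0.
have XE : vsval X = X0 by rewrite vsprojK.
have coordE i : root_coord e (Ad_star (G := G) (Exp X0)^-1%g xi) (alpha i) =
    expC (alpha i X) * root_coord e xi (alpha i).
  have [_ rs _] : [/\ root_space br (alpha i) (e (alpha i)),
      root_space br (- alpha i) (e (- alpha i))
      & killing br (e (alpha i)) (e (- alpha i)) = 1].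
    apply: he; split; first by have [+ _ _] := halpha; apply.
    exists (fun j => (j == i) : nat); rewrite (bigD1 i) //= eqxx big1 ?addr0 //.
    by move=> j /negbTE ->.
  have brN : br (- X0) (e (- alpha i)) = alpha i X *: e (- alpha i).
    by rewrite -scaleN1r lieZl -XE rs scalerA mulN1r opp_lfunE opprK.
  rewrite /root_coord /Ad_star comp_lfunE -(ExpN hExp) (Ad_Exp_eigen hExp brN).
  exact: linearZ.
have xi0 i : root_coord e xi (alpha i) != 0 by exact: xiU.
split.
  by move=> i; rewrite coordE mulf_neq0 // expC_neq0.
have [logP _] := hlog.
rewrite !gE.
(* alpha_k takes at Z the difference of two logarithms of one number. *)
pose Z := P (lg (Ad_star (G := G) (Exp X0)^-1%g xi)) - (X + P (lg xi)).
have Zk k : expC (alpha k Z) = 1.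
  rewrite /Z linearB linearD /= !simple_root_dual_sum // /lg.
  set w := root_coord e xi (alpha k).
  rewrite expCD coordE -/w.
  rewrite logP ?mulf_neq0 ?expC_neq0 //; last exact: xi0.
  have := expCN (alpha k X + log w).
  by rewrite expCD logP //; exact: xi0.
have EZ : Exp (vsval Z) = 1%g.
  have [nab _] := Lsimple.
  apply: (eq1_of_Ad_id hExp Gsimple nab).
  exact: (Ad_Exp_id hExp hcartan halpha).
have comm (A B : subvs_of h) : br (vsval A) (vsval B) = 0.
  by apply: hab; exact: subvsP.
have -> : P (lg (Ad_star (G := G) (Exp X0)^-1%g xi)) = Z + (X + P (lg xi)).
  by rewrite subrK.
clearbody Z; set Y := P (lg xi).
have vD (A B : subvs_of h) : Exp (vsval (A + B)) = (Exp (vsval A) * Exp (vsval B))%g.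
  by rewrite -(ExpD hExp (comm A B)) linearD.
by rewrite vD EZ mul1g vD XE.
Qed.
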